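(* Let $\Bbbk$ be a field, let $A=\Bbbk Q/I$ be a finite-dimensional directed $\Bbbk$-algebra (in the sense that the quiver $Q$ is acyclic), and let $B$ be a finite-dimensional self-injective $\Bbbk$-algebra. Then any left-right projective $A$-$B$-bimodule is projective as an $A$-$B$-bimodule.
   Context: All algebras are finite-dimensional, associative, unital $\Bbbk$-algebras, and all (bi)modules are finite-dimensional. Here $Q$ is a finite quiver and $I$ an admissible ideal of the path algebra $\Bbbk Q$. An $A$-$B$-bimodule $M$ is left-right projective if ${}_AM$ is a projective left $A$-module and $M_B$ is a projective right $B$-module; it is projective as a bimodule if it is projective as a left $A\otimes_\Bbbk B^{\mathrm{op}}$-module. *)

(* Defs.v *)
From HB Require Import structures.
From mathcomp Require Import all_boot all_order all_algebra all_field.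
From mathcomp Require Import finmap monalg.

Set Implicit Arguments.
Unset Strict Implicit.
Unset Printing Implicit Defensive.

Import GRing.Theory.
Local Open Scope ring_scope.

Section Modules.
Variable R : pzRingType.

Definition projective (P : lmodType R) : Prop :=
  forall (N N' : lmodType R) (g : {linear N -> N'}) (f : {linear P -> N'}),
    (forall y : N', exists x : N, g x = y) ->
    exists h : {linear P -> N}, forall x : P, g (h x) = f x.

Definition injective_module (E : lmodType R) : Prop :=
  forall (N N' : lmodType R) (g : {linear N -> N'}) (f : {linear N -> E}),
    injective g ->
    exists h : {linear N' -> E}, forall x : N, h (g x) = f x.

End Modules.

(* The opposite algebra B^op, carried by MathComp's converse ring B^c.        *)
Section Opposite.
Variables (k : fieldType) (B : falgType k).

HB.instance Definition _ := Vector.copy B^c B.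

Fact opp_scalerAl (c : k) (x y : B^c) : c *: (x * y : B^c) = ((c *: x : B^c) * y).
Proof. exact: (@scalerAr k B c y x). Qed.
HB.instance Definition _ := GRing.Lmodule_isLalgebra.Build k B^c opp_scalerAl.

Fact opp_scalerAr (c : k) (x y : B^c) : c *: (x * y : B^c) = x * (c *: y : B^c).
Proof. exact: (@scalerAl k B c y x). Qed.
HB.instance Definition _ := GRing.Lalgebra_isAlgebra.Build k B^c opp_scalerAr.

End Opposite.

(* A right B-module is a left B^c-module; the condition says that the regular *)
(* right module B_B is injective.                                             *)
Definition self_injective (k : fieldType) (B : falgType k) : Prop :=
  injective_module (B^c)^o.

(* V (x) W is encoded by coordinates with respect to the bases of V and W     *)
(* provided by the library.                                                   *)
Definition tens (k : fieldType) (V W : vectType k) : Type :=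
  'M[k]_(\dim {:V}, \dim {:W}).

Section Tensor.
Variables (k : fieldType) (V W : vectType k).

HB.instance Definition _ := Vector.copy (tens V W) 'M[k]_(\dim {:V}, \dim {:W}).

Definition tens_pure (v : V) (w : W) : tens V W :=
  \matrix_(i, j) (coord (vbasis {:V}) i v * coord (vbasis {:W}) j w).

Definition is_bilinear (X : lmodType k) (F : V -> W -> X) : Prop :=
  (forall w, linear (F^~ w)) /\ (forall v, linear (F v)).

(* The linear map on V (x) W induced by a bilinear map F on V x W.            *)
Definition tens_lift (X : lmodType k) (F : V -> W -> X) (t : tens V W) : X :=
  \sum_i \sum_j (t : 'M[k]_(_, _)) i j *: F (vbasis {:V})`_i (vbasis {:W})`_j.

Lemma tens_lift_linear (X : lmodType k) (F : V -> W -> X) : linear (tens_lift F).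
Proof.
move=> c t u; rewrite /tens_lift scaler_sumr -big_split; apply: eq_bigr => i _.
rewrite /= scaler_sumr -big_split; apply: eq_bigr => j _ /=.
by rewrite !mxE scalerDl scalerA.
Qed.

Lemma tens_pure_bilinear : is_bilinear tens_pure.
Proof.
split=> [w c v v'|v c w w']; apply/matrixP=> i j; rewrite !mxE linearP /=.
  by rewrite mulrDl mulrA.
by rewrite mulrDr mulrCA.
Qed.

Lemma tens_lift_pure (X : lmodType k) (F : V -> W -> X) v w :
  is_bilinear F -> tens_lift F (tens_pure v w) = F v w.
Proof.
case=> Fl Fr.
pose fl w' : {linear V -> X} := HB.pack (F^~ w')
  (GRing.isLinear.Build k V X _ (F^~ w') (Fl w')).
pose fr v' : {linear W -> X} := HB.pack (F v')
  (GRing.isLinear.Build k W X _ (F v') (Fr v')).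
have -> : F v w = fl w v by [].
rewrite {2}(coord_vbasis (memvf v)) linear_sum; apply: eq_bigr => i _.
rewrite linearZ /= -[F _ w]/(fr _ w).
rewrite {2}(coord_vbasis (memvf w)) linear_sum scaler_sumr.
by apply: eq_bigr => j _; rewrite linearZ /= !mxE scalerA.
Qed.

Lemma tensE (t : tens V W) : t = tens_lift tens_pure t.
Proof.
apply/matrixP=> i j; rewrite /tens_lift summxE (bigD1 i) //= summxE.
rewrite (bigD1 j) //= !mxE !coord_free ?(basis_free (vbasisP _)) //.
rewrite !eqxx !mulr1 !big1 ?addr0 // => [i'|j'] ne.
  rewrite summxE big1 // => j' _; rewrite !mxE.
  rewrite !coord_free ?(basis_free (vbasisP _)) //.
  by rewrite (negbTE (ne : is_true (i' != i))) mul0r mulr0.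
rewrite !mxE !coord_free ?(basis_free (vbasisP _)) //.
by rewrite (negbTE (ne : is_true (j' != j))) !mulr0.
Qed.

Lemma tens_linearP (X : lmodType k) (f g : tens V W -> X) :
    linear f -> linear g ->
    (forall v w, f (tens_pure v w) = g (tens_pure v w)) ->
  forall t, f t = g t.
Proof.
move=> lf lg fg t.
pose f' : {linear tens V W -> X} := HB.pack f
  (GRing.isLinear.Build k (tens V W) X _ f lf).
pose g' : {linear tens V W -> X} := HB.pack g
  (GRing.isLinear.Build k (tens V W) X _ g lg).
rewrite -[f t]/(f' t) -[g t]/(g' t) (tensE t) !linear_sum.
apply: eq_bigr => i _; rewrite !linear_sum; apply: eq_bigr => j _.
by rewrite !linearZ /= fg.
Qed.

End Tensor.

Section TensorAlgebra.
Variables (k : fieldType) (A B : falgType k).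
Notation T := (tens A B).

Definition tens_one : T := tens_pure 1 1.

(* (a (x) b) * (a' (x) b') = a a' (x) b b' *)
Definition tens_mul (t u : T) : T :=
  tens_lift (fun a b => tens_lift (fun a' b' => tens_pure (a * a') (b * b')) u) t.

Fact tens_mul_bilinear_r a b :
  is_bilinear (fun a' b' => tens_pure (a * a') (b * b') : T).
Proof.
have [pl pr] := tens_pure_bilinear A B.
by split=> [b' c x y|a' c x y]; rewrite mulrDr -scalerAr (pl, pr).
Qed.

Fact tens_mul_bilinear_l (u : T) : is_bilinear (fun a b =>
  tens_lift (fun a' b' => tens_pure (a * a') (b * b')) u).
Proof.
have [pl pr] := tens_pure_bilinear A B.
split=> [b c x y|a c x y]; rewrite /tens_lift scaler_sumr -big_split;
  apply: eq_bigr => i _; rewrite /= scaler_sumr -big_split; apply: eq_bigr => j _ /=.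
  by rewrite mulrDl -scalerAl pl scalerDr !scalerA mulrC.
by rewrite mulrDl -scalerAl pr scalerDr !scalerA mulrC.
Qed.

Lemma tens_mul_pure a b a' b' :
  tens_mul (tens_pure a b) (tens_pure a' b') = tens_pure (a * a') (b * b').
Proof.
rewrite /tens_mul tens_lift_pure; last exact: tens_mul_bilinear_l.
by rewrite tens_lift_pure //; apply: tens_mul_bilinear_r.
Qed.

Fact tens_mul_linl c t u v : tens_mul (c *: t + u) v = c *: tens_mul t v + tens_mul u v.
Proof. exact: tens_lift_linear. Qed.

Fact tens_mul_linr c t u v : tens_mul t (c *: u + v) = c *: tens_mul t u + tens_mul t v.
Proof.
rewrite /tens_mul {1 3 5}/tens_lift scaler_sumr -big_split.
apply: eq_bigr => i _; rewrite /= scaler_sumr -big_split; apply: eq_bigr => j _ /=.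
by rewrite tens_lift_linear scalerDr !scalerA mulrC.
Qed.

Fact tens_mulA : associative tens_mul.
Proof.
move=> t u v; move: t; apply: tens_linearP => [c x y|c x y|a b].
- by rewrite tens_mul_linl.
- by rewrite !tens_mul_linl.
move: u; apply: tens_linearP => [c x y|c x y|a' b'].
- by rewrite tens_mul_linl tens_mul_linr.
- by rewrite tens_mul_linr tens_mul_linl.
move: v; apply: tens_linearP => [c x y|c x y|a2 b2].
- by rewrite !tens_mul_linr.
- by rewrite !tens_mul_linr.
by rewrite !tens_mul_pure !mulrA.
Qed.

Fact tens_mul1l : left_id tens_one tens_mul.
Proof.
apply: tens_linearP => [c x y|c x y|a b]; first by rewrite tens_mul_linr.
  by [].
by rewrite tens_mul_pure !mul1r.
Qed.

Fact tens_mul1r : right_id tens_one tens_mul.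
Proof.
apply: tens_linearP => [c x y|c x y|a b]; first by rewrite tens_mul_linl.
  by [].
by rewrite tens_mul_pure !mulr1.
Qed.

Fact tens_mulDl : left_distributive tens_mul +%R.
Proof. by move=> x y z; rewrite -[x]scale1r tens_mul_linl !scale1r. Qed.

Fact tens_mulDr : right_distributive tens_mul +%R.
Proof. by move=> x y z; rewrite -[y]scale1r tens_mul_linr !scale1r. Qed.

Fact tens_one_neq0 : tens_one != 0.
Proof.
have nz (C : falgType k) : exists i, coord (vbasis {:C}) i 1 != 0.
  apply/existsP; apply: contraT; rewrite negb_exists => /forallP z.
  have := oner_neq0 C; rewrite [1](coord_vbasis (memvf _)) big1 ?eqxx // => i _.
  by move: (z i); rewrite negbK => /eqP->; rewrite scale0r.
have [[i ai] [j bj]] := (nz A, nz B).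
apply/eqP => /matrixP /(_ i j); rewrite !mxE => /eqP.
by rewrite mulf_eq0 (negbTE ai) (negbTE bj).
Qed.

HB.instance Definition _ := GRing.Zmodule_isNzRing.Build T
  tens_mulA tens_mul1l tens_mul1r tens_mulDl tens_mulDr tens_one_neq0.

Fact tens_scalerAl c (x y : T) : c *: (x * y) = (c *: x : T) * y.
Proof.
have := tens_mul_linl c x 0 y; rewrite addr0 => E.
apply/esym; apply: etrans E _; by rewrite -[tens_mul 0 y]/(0 * y) mul0r addr0.
Qed.
HB.instance Definition _ := GRing.Lmodule_isLalgebra.Build k T tens_scalerAl.

Fact tens_scalerAr c (x y : T) : c *: (x * y) = x * (c *: y : T).
Proof.
have := tens_mul_linr c x y 0; rewrite addr0 => E.
apply/esym; apply: etrans E _; by rewrite -[tens_mul x 0]/(x * 0) mulr0 addr0.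
Qed.
HB.instance Definition _ := GRing.Lalgebra_isAlgebra.Build k T tens_scalerAr.
HB.instance Definition _ := Algebra_isFalgebra.Build k T.

Lemma tens_pureM a b a' b' :
  (tens_pure a b : T) * tens_pure a' b' = tens_pure (a * a') (b * b').
Proof. exact: tens_mul_pure. Qed.

Lemma tens_pure1 : tens_pure 1 1 = 1 :> T.
Proof. by []. Qed.

End TensorAlgebra.

(* Finite-dimensional A-B-bimodules on which k acts centrally.                *)
Record bimodule (k : fieldType) (A B : falgType k) := Bimodule {
  bimod_sort :> vectType k;
  lact : A -> bimod_sort -> bimod_sort;
  ract : bimod_sort -> B -> bimod_sort;
  lactDl : forall a a' m, lact (a + a') m = lact a m + lact a' m;
  lactDr : forall a m m', lact a (m + m') = lact a m + lact a m';
  lact1 : forall m, lact 1 m = m;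
  lactM : forall a a' m, lact (a * a') m = lact a (lact a' m);
  ractDl : forall m m' b, ract (m + m') b = ract m b + ract m' b;
  ractDr : forall m b b', ract m (b + b') = ract m b + ract m b';
  ract1 : forall m, ract m 1 = m;
  ractM : forall m b b', ract m (b * b') = ract (ract m b) b';
  lractA : forall a m b, lact a (ract m b) = ract (lact a m) b;
  lact_scalar : forall c m, lact (c *: 1) m = c *: m;
  ract_scalar : forall c m, ract m (c *: 1) = c *: m
}.

Section Bimodule.
Variables (k : fieldType) (A B : falgType k) (M : bimodule A B).

Definition left_module : Type := M.
HB.instance Definition _ := GRing.Zmodule.copy left_module M.

Fact left_scalerA (a a' : A) (m : left_module) :
  lact a (lact a' m) = lact (a * a') m.
Proof. by rewrite lactM. Qed.
HB.instance Definition _ := GRing.Zmodule_isLmodule.Build A left_module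
  left_scalerA (@lact1 _ _ _ M) (@lactDr _ _ _ M)
  (fun m a a' => @lactDl _ _ _ M a a' m).

Definition right_module : Type := M.
HB.instance Definition _ := GRing.Zmodule.copy right_module M.

Definition right_scale (b : B^c) (m : right_module) : right_module := ract m b.
Fact right_scalerA b b' m :
  right_scale b (right_scale b' m) = right_scale (b * b') m.
Proof. by rewrite /right_scale -ractM. Qed.
Fact right_scale1r : left_id 1 right_scale.
Proof. exact: ract1. Qed.
Fact right_scalerDr : right_distributive right_scale +%R.
Proof. by move=> b m m'; apply: ractDl. Qed.
Fact right_scalerDl m : {morph right_scale^~ m : b b' / b + b'}.
Proof. by move=> b b'; apply: ractDr. Qed.
HB.instance Definition _ := GRing.Zmodule_isLmodule.Build B^c right_module
  right_scalerA right_scale1r right_scalerDr right_scalerDl.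

(* M as a left module over A (x) B^op, with (a (x) b) m = a m b.              *)
Definition enveloping_module : Type := M.
HB.instance Definition _ := GRing.Zmodule.copy enveloping_module M.

Definition env_scale (t : tens A B^c) (m : enveloping_module) :
  enveloping_module := tens_lift (fun (a : A) (b : B^c) => lact a (ract m b)) t.

Fact lactZ c a (m : M) : lact (c *: a) m = c *: lact a m.
Proof. by rewrite -[a in LHS]mul1r scalerAl lactM lact_scalar. Qed.
Fact ractZ c (m : M) b : ract m (c *: b) = c *: ract m b.
Proof. by rewrite -[b in LHS]mulr1 scalerAr ractM ract_scalar. Qed.
Fact lactZr c a (m : M) : lact a (c *: m) = c *: lact a m.
Proof. by rewrite -!lact_scalar -!lactM -scalerAr -scalerAl mulr1 mul1r. Qed.
Fact ractZl c (m : M) b : ract (c *: m) b = c *: ract m b.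
Proof. by rewrite -!ract_scalar -!ractM -scalerAr -scalerAl mulr1 mul1r. Qed.

Fact env_bilinear (m : M) :
  is_bilinear (fun (a : A) (b : B^c) => lact a (ract m b)).
Proof.
split=> [b c x y|a c x y]; first by rewrite lactDl lactZ.
by rewrite ractDr ractZ lactDr lactZr.
Qed.

Lemma env_scale_pure a b (m : M) : env_scale (tens_pure a b) m = lact a (ract m b).
Proof. by rewrite /env_scale tens_lift_pure //; apply: env_bilinear. Qed.

Fact env_scale_linl c t u (m : M) :
  env_scale (c *: t + u) m = c *: (env_scale t m : M) + env_scale u m :> M.
Proof. exact: tens_lift_linear. Qed.

Fact env_scale_linr t c (m m' : M) :
  env_scale t (c *: m + m') = c *: (env_scale t m : M) + env_scale t m' :> M.
Proof.
rewrite /env_scale /tens_lift scaler_sumr -big_split.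
apply: eq_bigr => i _; rewrite /= scaler_sumr -big_split; apply: eq_bigr => j _ /=.
by rewrite ractDl ractZl lactDr lactZr scalerDr !scalerA mulrC.
Qed.

Fact env_scalerA t u m : env_scale t (env_scale u m) = env_scale (t * u) m.
Proof.
move: t; apply: (@tens_linearP _ _ _ M) => [c x y|c x y|a b].
- exact: env_scale_linl.
- by rewrite mulrDl -scalerAl; apply: env_scale_linl.
move: u; apply: (@tens_linearP _ _ _ M) => [c x y|c x y|a' b'].
- by rewrite (env_scale_linl c x y) env_scale_linr.
- by rewrite mulrDr -scalerAr; apply: env_scale_linl.
rewrite tens_pureM !env_scale_pure -lractA -lactM; congr lact.
by rewrite -ractM.
Qed.
Fact env_scale1r : left_id 1 env_scale.
Proof. by move=> m; rewrite -tens_pure1 env_scale_pure ract1 lact1. Qed.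
Fact env_scalerDr : right_distributive env_scale +%R.
Proof.
move=> t m m'; have := env_scale_linr t 1 m m'.
by rewrite !scale1r.
Qed.
Fact env_scalerDl m : {morph env_scale^~ m : t u / t + u}.
Proof.
move=> t u; have := env_scale_linl 1 t u m.
by rewrite !scale1r.
Qed.
HB.instance Definition _ :=
  GRing.Zmodule_isLmodule.Build (tens A B^c) enveloping_module
  env_scalerA env_scale1r env_scalerDr env_scalerDl.

End Bimodule.

Record quiver := Quiver {
  vertex : finType;
  arrow : finType;
  src : arrow -> vertex;
  tgt : arrow -> vertex
}.

Section Paths.
Variable Q : quiver.

Fixpoint is_walk (x : vertex Q) (s : seq (arrow Q)) : bool :=
  if s is a :: s' then (src a == x) && is_walk (tgt a) s' else true.

Definition walk_end (x : vertex Q) (s : seq (arrow Q)) : vertex Q :=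
  last x (map (@tgt Q) s).

(* A path is a starting vertex x together with the sequence of its arrows in  *)
(* the order of traversal; the empty sequence gives the trivial path at x.    *)
Record qpath := QPath {
  qpath_val : vertex Q * seq (arrow Q);
  _ : is_walk qpath_val.1 qpath_val.2
}.

HB.instance Definition _ := [isSub for qpath_val].
HB.instance Definition _ := [Choice of qpath by <:].

Definition qstart (p : qpath) : vertex Q := (val p).1.
Definition qarrows (p : qpath) : seq (arrow Q) := (val p).2.
Definition qend (p : qpath) : vertex Q := walk_end (qstart p) (qarrows p).
Definition qlength (p : qpath) : nat := size (qarrows p).

Definition qtriv (x : vertex Q) : qpath := @QPath (x, [::]) isT.

Lemma is_walk_cat x s t :
  is_walk x (s ++ t) = is_walk x s && is_walk (walk_end x s) t.
Proof. by elim: s x => //= a s IHs x; rewrite IHs andbA. Qed.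

Fact qcat_subproof p q :
  qend p == qstart q -> is_walk (qstart p) (qarrows p ++ qarrows q).
Proof.
move=> /eqP pq; rewrite is_walk_cat (valP p) -/(qend p) pq; exact: (valP q).
Qed.

(* The path "first p, then q", when it exists.                                *)
Definition qcat (p q : qpath) : option qpath :=
  if @idP (qend p == qstart q) is ReflectT pq
  then Some (@QPath (qstart p, qarrows p ++ qarrows q) (qcat_subproof pq))
  else None.

(* Acyclic: there is no oriented cycle of positive length.                    *)
Definition acyclic : Prop :=
  forall p : qpath, qend p = qstart p -> qlength p = 0%N.

Lemma qcatP p q :
  (qend p = qstart q /\ exists r, [/\ qcat p q = Some r, qstart r = qstart p,
     qend r = qend q & qarrows r = qarrows p ++ qarrows q]) \/
  (qend p <> qstart q /\ qcat p q = None).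
Proof.
rewrite /qcat; case: {-}_ / idP => [pq|npq]; last first.
  by right; split=> // /eqP.
left; split; first exact/eqP; eexists; split=> //.
rewrite /qend /walk_end /qstart /qarrows /= map_cat last_cat.
by move/eqP: pq; rewrite /qend /walk_end /qstart /qarrows => ->.
Qed.

Lemma qpath_inj p q : qstart p = qstart q -> qarrows p = qarrows q -> p = q.
Proof.
move=> e1 e2; apply: val_inj; move: e1 e2; rewrite /qstart /qarrows.
by case: (val p) (val q) => ? ? [? ?] /= -> ->.
Qed.

Lemma qcatA p q r :
  obind (qcat p) (qcat q r) = obind (fun s => qcat s r) (qcat p q).
Proof.
case: (qcatP q r) => [[qr [u [-> us ue ua]]]|[qr ->]];
  case: (qcatP p q) => [[pq [v [-> vs ve va]]]|[pq ->]] //=.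
- case: (qcatP p u) => [[pu [w [-> ws we wa]]]|[[]]]; last by rewrite us.
  case: (qcatP v r) => [[vr [z [-> zs ze za]]]|[[]]]; last by rewrite ve.
  by congr Some; apply: qpath_inj; rewrite ?ws ?zs // wa za ua va catA.
- by case: (qcatP p u) => [[pu _]|[_ ->]] //; case: pq; rewrite pu.
by case: (qcatP v r) => [[vr _]|[_ ->]] //; case: qr; rewrite -ve.
Qed.

Lemma qcat1l x p : qcat (qtriv x) p = if x == qstart p then Some p else None.
Proof.
case: (qcatP (qtriv x) p) => [[xp [u [-> us ue ua]]]|[xp ->]].
  by rewrite -xp eqxx; congr Some; apply: qpath_inj => //; rewrite us.
by case: eqP => // e; case: xp.
Qed.

Lemma qcat1r x p : qcat p (qtriv x) = if qend p == x then Some p else None.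
Proof.
case: (qcatP p (qtriv x)) => [[xp [u [-> us ue ua]]]|[xp ->]].
  by rewrite xp eqxx; congr Some; apply: qpath_inj => //; rewrite ua /= cats0.
by case: eqP.
Qed.

End Paths.

Section PathAlgebra.
Variables (k : fieldType) (Q : quiver).

(* kQ: finitely supported families of scalars indexed by the paths of Q.      *)
Definition path_algebra : Type := {malg k[qpath Q]}.
HB.instance Definition _ := GRing.Lmodule.copy path_algebra {malg k[qpath Q]}.

Implicit Types (f g h : path_algebra) (p q : qpath Q) (c : k).

Definition pcoef (p : qpath Q) (f : path_algebra) : k := mcoeff p f.

(* [path_elt] and [pa_mul] are locked to keep unification from unfolding them. *)
Fact path_elt_key : unit. Proof. exact: tt. Qed.
Definition path_elt : qpath Q -> path_algebra :=
  locked_with path_elt_key (fun p => mkmalgU p 1).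
Canonical path_elt_unlockable := [unlockable fun path_elt].

Definition path_elt_mul (p q : qpath Q) : path_algebra :=
  if qcat p q is Some r then path_elt r else 0.

Fact pa_mul_key : unit. Proof. exact: tt. Qed.
Definition pa_mul : path_algebra -> path_algebra -> path_algebra :=
  locked_with pa_mul_key (fun f g =>
    \sum_(p <- msupp f) \sum_(q <- msupp g)
      (pcoef p f * pcoef q g) *: path_elt_mul p q).
Canonical pa_mul_unlockable := [unlockable fun pa_mul].

Definition pa_one : path_algebra := \sum_(x : vertex Q) path_elt (qtriv x).

Fact pcoefD p f g : pcoef p (f + g) = pcoef p f + pcoef p g.
Proof. exact: mcoeffD. Qed.
Fact pcoefZ p c f : pcoef p (c *: f) = c * pcoef p f.
Proof. exact: mcoeffZ. Qed.

Fact pa_mulw (d1 d2 : {fset qpath Q}) f g :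
  (msupp f `<=` d1)%fset -> (msupp g `<=` d2)%fset ->
  pa_mul f g = \sum_(p <- d1) \sum_(q <- d2)
    (pcoef p f * pcoef q g) *: path_elt_mul p q.
Proof.
move=> l1 l2; rewrite [pa_mul]unlock (big_fset_incl _ l1) /=.
  apply/eq_bigr=> p _; apply/big_fset_incl => // q _ /mcoeff_outdom e.
  by rewrite /pcoef e mulr0 scale0r.
move=> p _ /mcoeff_outdom e; rewrite big1 // => q _.
by rewrite /pcoef e mul0r scale0r.
Qed.

Fact pa_mul_linl c f g h : pa_mul (c *: f + g) h = c *: pa_mul f h + pa_mul g h.
Proof.
pose d := (msupp f `|` msupp g `|` msupp (c *: f + g)%R)%fset.
have l1 : (msupp f `<=` d)%fset by rewrite /d -fsetUA fsubsetUl.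
have l2 : (msupp g `<=` d)%fset by rewrite /d [(msupp f `|` _)%fset]fsetUC -fsetUA fsubsetUl.
have l3 : (msupp (c *: f + g)%R `<=` d)%fset by rewrite /d fsubsetUr.
have lh := fsubset_refl (msupp h).
rewrite (pa_mulw l1 lh) (pa_mulw l2 lh) (pa_mulw l3 lh).
rewrite scaler_sumr -big_split; apply: eq_bigr => p _ /=.
rewrite scaler_sumr -big_split; apply: eq_bigr => q _ /=.
by rewrite pcoefD pcoefZ scalerA -scalerDl mulrDl mulrA.
Qed.

Fact pa_mul_linr c f g h : pa_mul f (c *: g + h) = c *: pa_mul f g + pa_mul f h.
Proof.
pose d := (msupp g `|` msupp h `|` msupp (c *: g + h)%R)%fset.
have l1 : (msupp g `<=` d)%fset by rewrite /d -fsetUA fsubsetUl.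
have l2 : (msupp h `<=` d)%fset by rewrite /d [(msupp g `|` _)%fset]fsetUC -fsetUA fsubsetUl.
have l3 : (msupp (c *: g + h)%R `<=` d)%fset by rewrite /d fsubsetUr.
have lf := fsubset_refl (msupp f).
rewrite (pa_mulw lf l1) (pa_mulw lf l2) (pa_mulw lf l3).
rewrite scaler_sumr -big_split; apply: eq_bigr => p _ /=.
rewrite scaler_sumr -big_split; apply: eq_bigr => q _ /=.
by rewrite pcoefD pcoefZ scalerA -scalerDl mulrDr mulrCA.
Qed.

Lemma pa_mul_path p q : pa_mul (path_elt p) (path_elt q) = path_elt_mul p q.
Proof.
have le r : (msupp (path_elt r) `<=` [fset r])%fset.
  by rewrite [path_elt]unlock msuppU_le.
rewrite (@pa_mulw [fset p]%fset [fset q]%fset) ?le // !big_seq_fset1.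
have c r : pcoef r (path_elt r) = 1 by rewrite [path_elt]unlock; apply: mcoeffUU.
by rewrite !c mulr1 scale1r.
Qed.

Lemma path_algebraE f : f = \sum_(p <- msupp f) pcoef p f *: path_elt p.
Proof.
rewrite {1}[f]monalgE; apply: eq_bigr => p _; apply/malgP => q.
apply: etrans (mcoeffU _ _ _) _; apply: esym; apply: etrans (pcoefZ _ _ _) _.
by rewrite [path_elt]unlock [pcoef q _]mcoeffU mulr_natr.
Qed.

Lemma path_algebra_ind (P : path_algebra -> Prop) :
  P 0 -> (forall c f g, P f -> P g -> P (c *: f + g)) ->
  (forall p, P (path_elt p)) -> forall f, P f.
Proof.
move=> P0 Plin Pp f; rewrite [f]path_algebraE.
by elim/big_rec: _ => // p g _ Pg; apply: Plin.
Qed.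

Fact pa_mul0l f : pa_mul 0 f = 0.
Proof. by rewrite [pa_mul]unlock msupp0 big_seq_fset0. Qed.
Fact pa_mul0r f : pa_mul f 0 = 0.
Proof. by rewrite [pa_mul]unlock big1 // => p _; rewrite msupp0 big_seq_fset0. Qed.

Fact pa_mulA : associative pa_mul.
Proof.
move=> f g h; elim/path_algebra_ind: f => [|c f f' Ef Ef'|p].
- by rewrite (pa_mul0l g) (pa_mul0l h) pa_mul0l.
- by rewrite (pa_mul_linl c f f' g) (pa_mul_linl c f f') (pa_mul_linl c _ _ h) Ef Ef'.
elim/path_algebra_ind: g => [|c g g' Eg Eg'|q].
- by rewrite (pa_mul0l h) (pa_mul0r (path_elt p)) (pa_mul0l h).
- rewrite (pa_mul_linl c g g' h) (pa_mul_linr c (path_elt p) g g').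
  by rewrite (pa_mul_linr c (path_elt p)) (pa_mul_linl c _ _ h) Eg Eg'.
elim/path_algebra_ind: h => [|c h h' Eh Eh'|r].
- by rewrite (pa_mul0r (path_elt q)) (pa_mul0r (path_elt p)) pa_mul0r.
- rewrite (pa_mul_linr c (path_elt q) h h') (pa_mul_linr c (path_elt p)).
  by rewrite (pa_mul_linr c _ h h') Eh Eh'.
rewrite (pa_mul_path q r) (pa_mul_path p q) /path_elt_mul.
have := qcatA p q r; case: (qcat q r) => [u|]; case: (qcat p q) => [v|] /= E.
- by rewrite (pa_mul_path p u) (pa_mul_path v r) /path_elt_mul E.
- by rewrite (pa_mul_path p u) (pa_mul0l (path_elt r)) /path_elt_mul E.
- by rewrite (pa_mul_path v r) (pa_mul0r (path_elt p)) /path_elt_mul -E.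
by rewrite (pa_mul0l (path_elt r)) (pa_mul0r (path_elt p)).
Qed.

Fact pa_mulDl : left_distributive pa_mul +%R.
Proof. by move=> x y z; rewrite -[x]scale1r pa_mul_linl !scale1r. Qed.
Fact pa_mulDr : right_distributive pa_mul +%R.
Proof. by move=> x y z; rewrite -[y]scale1r pa_mul_linr !scale1r. Qed.

Fact pa_mul1l : left_id pa_one pa_mul.
Proof.
move=> f; elim/path_algebra_ind: f => [|c f f' Ef Ef'|p].
- by rewrite pa_mul0r.
- by rewrite pa_mul_linr Ef Ef'.
rewrite /pa_one (big_morph (pa_mul^~ _) (fun _ _ => pa_mulDl _ _ _) (pa_mul0l _)).
rewrite (bigD1 (qstart p)) //= big1 => [|x /negbTE ne].
  by rewrite pa_mul_path /path_elt_mul qcat1l eqxx addr0.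
by rewrite pa_mul_path /path_elt_mul qcat1l ne.
Qed.

Fact pa_mul1r : right_id pa_one pa_mul.
Proof.
move=> f; elim/path_algebra_ind: f => [|c f f' Ef Ef'|p].
- by rewrite pa_mul0l.
- by rewrite pa_mul_linl Ef Ef'.
rewrite /pa_one (big_morph (pa_mul _) (fun _ _ => pa_mulDr _ _ _) (pa_mul0r _)).
rewrite (bigD1 (qend p)) //= big1 => [|x /negbTE ne].
  by rewrite pa_mul_path /path_elt_mul qcat1r eqxx addr0.
by rewrite pa_mul_path /path_elt_mul qcat1r eq_sym ne.
Qed.

(* Only a [pzRingType]: for the empty quiver this is the zero ring.           *)
HB.instance Definition _ := GRing.Zmodule_isPzRing.Build path_algebra
  pa_mulA pa_mul1l pa_mul1r pa_mulDl pa_mulDr.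

Lemma path_eltM p q : path_elt p * path_elt q = path_elt_mul p q.
Proof. exact: pa_mul_path. Qed.

Definition two_sided_ideal (I : path_algebra -> Prop) : Prop :=
  [/\ I 0, (forall x y, I x -> I y -> I (x + y)),
      (forall a x, I x -> I (a * x)) & (forall a x, I x -> I (x * a))].

(* The n-th power of the arrow ideal is spanned by the paths of length >= n.  *)
Definition arrow_ideal_pow (n : nat) (x : path_algebra) : Prop :=
  forall p, pcoef p x != 0 -> (n <= qlength p)%N.

Definition admissible (I : path_algebra -> Prop) : Prop :=
  [/\ two_sided_ideal I,
      exists2 m, (2 <= m)%N & forall x, arrow_ideal_pow m x -> I x &
      forall x, I x -> arrow_ideal_pow 2 x].

(* A is the quotient kQ/I with projection pi: pi is a surjective morphism of  *)
(* unital k-algebras with kernel I.                                           *)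
Definition is_quotient_map (I : path_algebra -> Prop) (A : falgType k)
    (pi : {linear path_algebra -> A}) : Prop :=
  [/\ monoid_morphism pi, (forall a : A, exists x, pi x = a) &
      forall x, pi x = 0 <-> I x].

End PathAlgebra.

Section ProjectiveBimodules.
Variables (k : fieldType) (A B : falgType k).

Definition left_right_projective (M : bimodule A B) : Prop :=
  projective (left_module M) /\ projective (right_module M).

Definition bimodule_projective (M : bimodule A B) : Prop :=
  projective (enveloping_module M).

End ProjectiveBimodules.

(* Main.v *)
From HB Require Import structures.
Require Import Defs.
From mathcomp Require Import all_boot all_order all_algebra all_field.

(** Let J be the radical of [A], spanned by the classes of the nontrivial paths,
    and e_x the idempotent of the vertex x. A bimodule [M] that is projective on
    the right is a projective bimodule as soon as the multiplication map
    A (x) M -> M has a section of bimodules, for then it is a direct summand of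
    A (x) M, which is projective ([bimodule_projective_of_splits]).

    Such a section comes from a right submodule V of [M], stable under the e_x,
    that is a complement of J M. By Nakayama V generates [M], and as [M] is left
    projective, V generates it freely over the span E of the e_x: M = A (x)_E V,
    and the section sends v in e_x V to e_x (x) v ([diag_extension]).

    The complement V exists because the quiver is acyclic. Order the vertices so
    that e_x A e_z is nonzero for distinct x and z only if z has lower rank than
    x. Then e_x J M is the sum of the e_x J e_z M with z of lower rank. Suppose
    that the complement is already known in lower ranks. The section that it
    defines there embeds e_x J M as a direct summand in a finite sum of copies
    of [M], as a right module. The right module [M] is projective over the
    self-injective algebra [B], hence injective ([projective_injective]), so the
    coordinates of this embedding extend from e_x J M to [M]; composed with the
    multiplication they give a retraction of right modules onto e_x J M, whose
    kernel is the complement in e_x M ([radical_retract_step]). The induction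
    alternates between retractions and sections ([splits_everywhere]).

    Everything is done in coordinates: a map to A (x) M is a family of maps to
    [A], one for each basis vector of [M], or a family of maps to [M], one for
    each basis vector of [A]. *)

Set Implicit Arguments.
Unset Strict Implicit.
Unset Printing Implicit Defensive.

Import GRing.Theory.
Local Open Scope ring_scope.

(** * Finitely generated projective modules *)

Definition mk_linear (R : pzRingType) (U V : lmodType R) (f : U -> V)
    (f_linear : linear f) : {linear U -> V} :=
  HB.pack f (GRing.isLinear.Build R U V _ f f_linear).

Section FiniteProjective.
Variables (R : pzRingType) (P : lmodType R) (n : nat) (w : 'I_n -> P).
Hypothesis w_gen : forall m, exists t : 'I_n -> R, m = \sum_i t i *: w i.

(** A splitting of the surjection from the free module on the generators [w]. *)
Lemma dual_basis : projective P ->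
  exists phi : 'I_n -> {linear P -> R^o},
    forall m, m = \sum_i (phi i m : R) *: w i.
Proof.
move=> Pproj.
pose g (t : 'rV[R]_n) : P := \sum_i t 0 i *: w i.
have g_linear : linear g.
  move=> c t u; rewrite /g scaler_sumr -big_split; apply: eq_bigr => i _.
  by rewrite !mxE scalerDl scalerA.
have g_surj y : exists t, mk_linear g_linear t = y.
  have [t ->] := w_gen y; exists (\row_i t i).
  by apply: eq_bigr => i _; rewrite mxE.
have [h hK] := Pproj _ _ _ idfun g_surj.
pose phi i (m : P) : R^o := h m 0 i.
have phi_linear i : linear (phi i).
  by move=> c x y; rewrite /phi linearP !mxE.
exists (fun i => mk_linear (phi_linear i)).
by move=> m; rewrite -[LHS]/(idfun m) -hK.
Qed.

(** A finitely generated projective module is a direct summand of a finite power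
    of [R]: extend the coordinates of a map one by one. *)
Lemma projective_injective :
  injective_module R^o -> projective P -> injective_module P.
Proof.
move=> Rinj /dual_basis[phi phiK] N N' g f g_inj.
have /fin_all_exists[h hE] (i : 'I_n) :
    exists h : {linear N' -> R^o}, forall x, h (g x) = phi i (f x).
  by have [h hE] := Rinj _ _ g (phi i \o f) g_inj; exists h.
pose F y := \sum_i (h i y : R) *: w i.
have F_linear : linear F.
  move=> c x y; rewrite /F scaler_sumr -big_split; apply: eq_bigr => i _.
  by rewrite linearP scalerDl scalerA.
exists (mk_linear F_linear) => x; rewrite [RHS]phiK.
by apply: eq_bigr => i _; rewrite hE.
Qed.

End FiniteProjective.

(** * Extending linear maps to an injective module *)

Section Submodule.
Variables (R : pzRingType) (V : lmodType R) (S : submodClosed V).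
Inductive submodule : predArgType := Submodule x & x \in S.
Definition submodule_val (x : submodule) : V := let: Submodule y _ := x in y.
HB.instance Definition _ := [isSub of submodule for submodule_val].
HB.instance Definition _ := [Choice of submodule by <:].
HB.instance Definition _ := [SubChoice_isSubLmodule of submodule by <:].
End Submodule.

(** Injectivity of [E], applied to the inclusion of the submodule [S]. The map
    [f] is a function on [V] that is linear on [S] only: this keeps the subtype
    of [S] out of the statement. *)
Lemma injective_extend (R : pzRingType) (V E : lmodType R) (S : {pred V})
    (f : V -> E) :
  injective_module E -> submod_closed S ->
  {in S &, {morph f : x y / x + y}} ->
  (forall a, {in S, forall x, f (a *: x) = a *: f x}) ->
  exists h : {linear V -> E}, {in S, h =1 f}.
Proof.
move=> Einj S_closed fD fZ.
pose Sc : submodClosed V :=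
  HB.pack S (GRing.isSubmodClosed.Build R V S (GRing.submod_closed_semi S_closed)).
pose f' (x : submodule Sc) : E := f (val x).
have f'_linear : linear f'.
  move=> c x y; rewrite /f' linearP /= fD ?fZ ?(valP x) ?(valP y) //.
  by apply: (@rpredZ _ _ Sc); exact: (valP x).
have [h hE] := Einj _ _ (val : {linear submodule Sc -> V})
  (mk_linear f'_linear) val_inj.
by exists h => x Sx; have /= := hE (@Submodule _ _ Sc x Sx).
Qed.

(** * Triangular algebras *)

(** What acyclicity gives to the quotient of a path algebra: the trivial paths
    are orthogonal idempotents [e x], and [e x * A * e z], spanned by the classes
    of the paths from [x] to [z], is at most a line when [x = z] and can be
    nonzero for [x != z] only when the rank drops from [x] to [z]. *)
Record directed_frame (k : fieldType) (A : falgType k) (X : finType)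
    (e : X -> A) (rank : X -> nat) : Prop := DirectedFrame {
  frame_sum : \sum_x e x = 1;
  frame_idem : forall x, e x * e x = e x;
  frame_orth : forall x z, x != z -> e x * e z = 0;
  frame_scalar : forall x a, exists c, e x * a * e x = c *: e x;
  frame_triangular : forall x z a,
    x != z -> (rank x <= rank z)%N -> e x * a * e z = 0
}.

Section DirectedAlgebra.
Variables (k : fieldType) (A : falgType k) (X : finType).
Variables (e : X -> A) (rank : X -> nat).
Hypothesis frame : directed_frame e rank.

(** [diag] is the projection of [A] onto the span of the [e x] along the sum of
    the [e x * A * e z] with [x != z], and [offdiag] is the projection onto that
    sum, a nilpotent ideal with semisimple quotient, hence the radical. *)
Definition diag (a : A) : A := \sum_x e x * a * e x.
Definition offdiag (a : A) : A := a - diag a.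

Lemma frame_diagl x a : e x * diag a = e x * a * e x.
Proof.
rewrite /diag mulr_sumr (bigD1 x) //= big1 ?addr0 => [|z zx].
  by rewrite !mulrA (frame_idem frame).
by rewrite !mulrA (frame_orth frame) 1?eq_sym // !mul0r.
Qed.

Lemma frame_diagr x a : diag a * e x = e x * a * e x.
Proof.
rewrite /diag mulr_suml (bigD1 x) //= big1 ?addr0 => [|z zx].
  by rewrite -!mulrA (frame_idem frame).
by rewrite -!mulrA (frame_orth frame) // !mulr0.
Qed.

Fact diag_linear : linear diag.
Proof.
move=> c a b; rewrite /diag scaler_sumr -big_split; apply: eq_bigr => x _ /=.
by rewrite mulrDr mulrDl -scalerAr -scalerAl.
Qed.
HB.instance Definition _ := GRing.isLinear.Build k A A _ diag diag_linear.

Fact offdiag_linear : linear offdiag.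
Proof. by move=> c a b; rewrite /offdiag linearP scalerBr opprD addrACA. Qed.
HB.instance Definition _ := GRing.isLinear.Build k A A _ offdiag offdiag_linear.

Lemma diag_frame x : diag (e x) = e x.
Proof.
rewrite -[LHS]mul1r -(frame_sum frame) mulr_suml (bigD1 x) //=.
rewrite frame_diagl !(frame_idem frame) big1 ?addr0 // => z zx.
by rewrite frame_diagl (frame_orth frame zx) mul0r.
Qed.

(** A cross term [e x * a * e z * b * e x] with [x != z] would need the rank to
    drop both from [x] to [z] and from [z] to [x]. *)
Lemma diagM a b : diag (a * b) = diag a * diag b.
Proof.
rewrite {2}/diag mulr_suml; apply: eq_bigr => x _.
rewrite -[RHS]mulrA frame_diagl -[a in LHS]mulr1 -(frame_sum frame).
rewrite mulr_sumr mulr_suml mulr_sumr mulr_suml (bigD1 x) //= big1 => [|z zx].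
  by rewrite addr0 !mulrA.
have [le_xz|lt_zx] := leqP (rank x) (rank z).
  by rewrite !mulrA (frame_triangular frame) 1?eq_sym // !mul0r.
rewrite -!mulrA [e z * _]mulrA (frame_triangular frame) ?mulr0 //.
exact: ltnW.
Qed.

Lemma diag_diag a : diag (diag a) = diag a.
Proof.
rewrite [X in diag X]/diag linear_sum; apply: eq_bigr => x _ /=.
by rewrite !diagM diag_frame frame_diagl -mulrA (frame_idem frame).
Qed.

Lemma diag_offdiag a : diag (offdiag a) = 0.
Proof. by rewrite linearB /= diag_diag subrr. Qed.

Lemma diag_add_offdiag a : a = diag a + offdiag a.
Proof. by rewrite addrC subrK. Qed.

Lemma offdiag_frame_mul x a : offdiag (e x * a) = e x * offdiag a.
Proof. by rewrite /offdiag diagM diag_frame mulrBr. Qed.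

Lemma offdiag_corner x z a :
  (rank x <= rank z)%N -> e x * offdiag a * e z = 0.
Proof.
have [<- _|xz le_xz] := eqVneq x z; last exact: (frame_triangular frame).
by rewrite -frame_diagl diag_offdiag mulr0.
Qed.

Section Extension.
Variables (M N : lmodType A) (n : nat) (w : 'I_n -> M).
Variable phi : 'I_n -> {linear M -> A^o}.
Hypothesis phiK : forall m, m = \sum_i (phi i m : A) *: w i.

(** As the kernel of [diag] is the radical J of [A], these are the additive maps
    that kill J [V] and are linear over the span of the [e x]. *)
Definition diag_semilinear (V W : lmodType A) (u : V -> W) : Prop :=
  {morph u : x y / x + y} /\ forall a m, u (a *: m) = diag a *: u m.

(** The kernel of [p] contains J [M], so its image is a part of the top
    [M] / J [M] of the projective module [M]. The submodule it generates is free
    on it over the span of the [e x], and this is the universal property: a map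
    [u] given on the image of [p] is there the restriction of an [A]-linear map.
    The dual basis gives a first candidate, [m |-> \sum_i phi i m *: u (w i)]. It
    differs from [u] by terms [offdiag (phi i m) *: u (w i)], which on [e x *: M]
    involve the values of [u] on the [e z *: M] with [rank z < rank x] only. So
    correcting by candidates makes the error vanish on one more rank each time,
    starting from the lowest. *)
Lemma diag_extension (p : M -> M) (u : M -> N) :
  diag_semilinear p -> (forall m, p (p m) = p m) ->
  diag_semilinear u -> (forall m, u (p m) = u m) ->
  exists v : {linear M -> N}, forall m, v (p m) = u m.
Proof.
move=> [pD pZ] pp.
have semil0 (V W : lmodType A) (f : V -> W) : diag_semilinear f -> f 0 = 0.
  by case=> _ fZ; rewrite -(scale0r 0) fZ linear0 scale0r.
pose r := \max_x (rank x).+1.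
have rP x : (rank x < r)%N by exact: (leq_bigmax x).
(* d counts the ranks, from the top, on which u may still be nonzero. *)
suff main d : forall u, diag_semilinear u -> (forall m, u (p m) = u m) ->
    (forall z m, (rank z < r - d)%N -> u (e z *: m) = 0) ->
    exists v : {linear M -> N}, forall m, v (p m) = u m.
  by move=> su up; apply: (main r) => // z m; rewrite subnn.
elim: d => [|d IHd] {}u su up u0.
  exists \0 => m /=; rewrite -[m in RHS]scale1r -(frame_sum frame).
  rewrite scaler_suml (big_morph u su.1 (semil0 _ _ _ su)) big1 // => x _.
  by rewrite u0 // subn0 rP.
pose v m : N := \sum_i (phi i m : A) *: u (w i).
have v_linear : linear v.
  move=> c x y; rewrite /v scaler_sumr -big_split; apply: eq_bigr => i _.
  by rewrite linearP scalerDl scalerA.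
pose vl := mk_linear v_linear.
have vE m x : (rank x <= r - d.+1)%N -> v (e x *: m) = u (e x *: m).
  move=> le_x; rewrite [in RHS](phiK m) scaler_sumr.
  rewrite (big_morph u su.1 (semil0 _ _ _ su)); apply: eq_bigr => i _.
  have -> : (phi i (e x *: m) : A) = e x * phi i m by rewrite linearZ.
  rewrite scalerA su.2 [in LHS](diag_add_offdiag (phi i m)).
  rewrite mulrDr scalerDl diagM diag_frame -[RHS]addr0; congr (_ + _).
  rewrite -[u _]scale1r -(frame_sum frame) scaler_suml scaler_sumr.
  rewrite big1 // => z _; rewrite scalerA.
  have [lt_z|le_z] := ltnP (rank z) (r - d.+1)%N.
    have := u0 z (w i) lt_z; rewrite su.2 diag_frame => uz0.
    by rewrite -scalerA uz0 scaler0.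
  by rewrite offdiag_corner ?scale0r // (leq_trans le_x).
pose u1 m := u m - v (p m).
have vpZ a m : v (p (a *: m)) = diag a *: v (p m).
  by rewrite pZ -[v]/(vl : _ -> _) linearZ.
have [||z m lt_z|v1 v1E] := IHd u1.
- split=> [x y|a m]; last by rewrite /u1 su.2 vpZ scalerBr.
  by rewrite /u1 su.1 pD -[v]/(vl : _ -> _) linearD /= opprD addrACA.
- by move=> m; rewrite /u1 up pp.
- rewrite /u1 pZ diag_frame vE; last by rewrite -ltnS (leq_trans lt_z) // subnS leqSpred.
  by rewrite su.2 su.2 up subrr.
exists (vl \+ v1) => m /=.
by rewrite v1E /u1 /= addrC subrK.
Qed.

End Extension.
End DirectedAlgebra.

(** * The action maps of a bimodule *)

Section BasisVector.
Variables (k : fieldType) (V : vectType k).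

Definition basis_vec (i : 'I_(\dim {:V})) : V := (vbasis {:V})`_i.

Lemma basis_vecE (v : V) : v = \sum_i coord (vbasis {:V}) i v *: basis_vec i.
Proof. exact: (coord_vbasis (memvf v)). Qed.

End BasisVector.

Section BimoduleBasics.
Variables (k : fieldType) (A B : falgType k) (M : bimodule A B).

Fact lact_linear (a : A) : linear (@lact _ _ _ M a).
Proof. by move=> c x y; rewrite lactDr lactZr. Qed.
HB.instance Definition _ a :=
  GRing.isLinear.Build k M M _ (@lact _ _ _ M a) (lact_linear a).

Fact lact_linear_l (m : M) : linear (fun a : A => lact a m).
Proof. by move=> c x y; rewrite lactDl lactZ. Qed.

Lemma lact_suml I r (P : pred I) (F : I -> A) (m : M) :
  lact (\sum_(i <- r | P i) F i) m = \sum_(i <- r | P i) lact (F i) m.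
Proof. exact: (linear_sum (mk_linear (lact_linear_l m))). Qed.

Lemma lact0l (m : M) : lact 0 m = 0.
Proof. exact: (linear0 (mk_linear (lact_linear_l m))). Qed.

Fact ract_linear (b : B) : linear (fun m : M => ract m b).
Proof. by move=> c x y; rewrite ractDl ractZl. Qed.

Lemma ract0 b : ract 0 b = 0 :> M.
Proof. exact: (linear0 (mk_linear (ract_linear b))). Qed.

Lemma ractB (x y : M) b : ract (x - y) b = ract x b - ract y b.
Proof. exact: (linearB (mk_linear (ract_linear b))). Qed.

Lemma ract_suml I r (P : pred I) (F : I -> M) b :
  ract (\sum_(i <- r | P i) F i) b = \sum_(i <- r | P i) ract (F i) b.
Proof. exact: (linear_sum (mk_linear (ract_linear b))). Qed.

Lemma basis_vec_gen_left (m : left_module M) :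
  exists t : 'I_(\dim {:M}) -> A, m = \sum_i t i *: (@basis_vec k M i : left_module M).
Proof.
exists (fun i => coord (vbasis {:M}) i m *: 1).
by rewrite {1}[m]basis_vecE; apply: eq_bigr => i _; rewrite -lact_scalar.
Qed.

Lemma basis_vec_gen_right (m : right_module M) :
  exists t : 'I_(\dim {:M}) -> B^c, m = \sum_i t i *: (@basis_vec k M i : right_module M).
Proof.
exists (fun i => coord (vbasis {:M}) i m *: 1).
by rewrite {1}[m]basis_vecE; apply: eq_bigr => i _; rewrite -ract_scalar.
Qed.

(** * Bimodule sections of the multiplication map *)

Definition right_linear (f : M -> M) : Prop :=
  {morph f : x y / x + y} /\ forall m b, f (ract m b) = ract (f m) b.

Lemma right_linear_k f : right_linear f -> linear f.
Proof. by case=> fD fR c x y; rewrite fD -!ract_scalar fR. Qed.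

(** Such a family is a left [A]-linear map from [M] to A (x) M, written in the
    basis of [M]: it sends [m] to the sum of the theta_l(m) (x) w_l. *)
Definition left_family (theta : 'I_(\dim {:M}) -> M -> A) : Prop :=
  (forall l, {morph theta l : x y / x + y}) /\
  forall l a m, theta l (lact a m) = a * theta l m.

(** At [m], the map to A (x) M given by [theta] is a section of the
    multiplication map A (x) M -> M and commutes with the action of [B]: the
    scalars in the second condition are the matrix entries of the action of [b]
    in the basis of [M]. *)
Definition splits_at (theta : 'I_(\dim {:M}) -> M -> A) (m : M) : Prop :=
  m = \sum_l lact (theta l m) (basis_vec l) /\
  forall b l', theta l' (ract m b) =
    \sum_l coord (vbasis {:M}) l' (ract (basis_vec l) b) *: theta l m.

Section SplitsAt.
Variable theta : 'I_(\dim {:M}) -> M -> A.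
Hypothesis theta_left : left_family theta.

Lemma splits_at_lact a m : splits_at theta m -> splits_at theta (lact a m).
Proof.
case: theta_left => tD tL [mE mR]; split.
  rewrite {1}mE linear_sum; apply: eq_bigr => l _.
  by rewrite tL lactM.
move=> b l'; rewrite -lractA tL mR mulr_sumr; apply: eq_bigr => l _.
by rewrite tL scalerAr.
Qed.

Lemma splits_atD x y :
  splits_at theta x -> splits_at theta y -> splits_at theta (x + y).
Proof.
case: theta_left => tD _ [xE xR] [yE yR]; split.
  rewrite {1}xE {1}yE -big_split; apply: eq_bigr => l _.
  by rewrite tD lactDl.
move=> b l'; rewrite ractDl tD xR yR -big_split; apply: eq_bigr => l _.
by rewrite tD scalerDr.
Qed.

Lemma splits_at0 : splits_at theta 0.
Proof.
have t0 l : theta l 0 = 0 by rewrite -(lact0l 0) theta_left.2 mul0r.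
split; first by rewrite big1 // => l _; rewrite t0 lact0l.
move=> b l'; rewrite ract0 t0 big1 // => l _.
by rewrite t0 scaler0.
Qed.

Lemma splits_at_sum I r (P : pred I) (F : I -> M) :
  (forall i, P i -> splits_at theta (F i)) ->
  splits_at theta (\sum_(i <- r | P i) F i).
Proof.
by move=> sF; apply: big_ind => //; [exact: splits_at0|exact: splits_atD].
Qed.

End SplitsAt.
End BimoduleBasics.

(** * Building the section vertex by vertex *)

Section Induction.
Variables (k : fieldType) (A B : falgType k) (M : bimodule A B).
Variables (X : finType) (e : X -> A) (rank : X -> nat).
Hypothesis frame : directed_frame e rank.
Local Notation off := (offdiag e).
Local Notation dg := (diag e).
Local Notation w := (@basis_vec k M).
Local Notation co := (coord (vbasis {:M})).
Local Notation abas := (@basis_vec k A).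

Lemma lact_frame_sum (m : M) : m = \sum_x lact (e x) m.
Proof. by rewrite -lact_suml (frame_sum frame) lact1. Qed.

(** Multiplication by [e x * offdiag a] only sees the components [e z m] of
    lower rank. *)
Lemma splits_at_offdiag theta (x : X) a (m : M) :
  left_family theta ->
  (forall z m, (rank z < rank x)%N -> splits_at theta (lact (e z) m)) ->
  splits_at theta (lact (e x * off a) m).
Proof.
move=> tl IH; rewrite [m]lact_frame_sum linear_sum.
apply: splits_at_sum => // z _; rewrite /=.
have [le_xz|/IH lt_zx] := leqP (rank x) (rank z); last exact: splits_at_lact.
by rewrite -lactM (offdiag_corner frame) // lact0l; apply: splits_at0.
Qed.

(** With J the radical of [A], the map [m |-> \sum_i offdiag (a_i) (sigma_i m)]
    is a [B]-linear map from [M] to J M that is the identity on the part of J M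
    of rank below [n]. Keeping the [sigma_i] instead of their sum records that
    its values are in J M. *)
Definition radical_retract (n : nat) : Prop :=
  exists sigma : 'I_(\dim {:A}) -> M -> M,
    (forall i, right_linear (sigma i)) /\
    forall x a m, (rank x < n)%N ->
      \sum_i lact (off (abas i)) (sigma i (lact (e x * off a) m)) =
      lact (e x * off a) m.

(** The section over the part of [M] generated in rank below [n], extended to
    all of [M] by some [A]-linear map. *)
Definition splits_below (n : nat) : Prop :=
  exists theta : 'I_(\dim {:M}) -> M -> A, left_family theta /\
    forall x m, (rank x < n)%N -> splits_at theta (lact (e x) m).

(** Subtracting the retraction [q] onto the radical and keeping the components
    of rank below [n] gives a projection [p] whose image is a [B]-stable
    complement of J M below rank [n]. Since [M] is left projective, the map
    sending [p m] to the sum of the e_x (x) e_x p(m) extends to a left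
    [A]-linear map to A (x) M. The extension splits on the image of [p],
    and by Nakayama, as an induction on the rank, this image generates all
    [e x M] of rank below [n]. *)
Lemma splits_below_of_retract n :
  projective (left_module M) -> radical_retract n -> splits_below n.
Proof.
move=> Mproj [sigma [sigma_right sigmaK]].
have [phi phiK] := dual_basis (@basis_vec_gen_left _ _ _ M) Mproj.
pose q m := \sum_i lact (off (abas i)) (sigma i m).
have qD : {morph q : x y / x + y}.
  move=> x y; rewrite /q -big_split; apply: eq_bigr => i _.
  by rewrite (sigma_right i).1 lactDr.
have qR m b : q (ract m b) = ract (q m) b.
  rewrite ract_suml; apply: eq_bigr => i _.
  by rewrite (sigma_right i).2 lractA.
have q_linear := right_linear_k (conj qD qR).
pose ql := mk_linear q_linear.
pose p m := \sum_(x | (rank x < n)%N) lact (e x) (lact (e x) m - q (lact (e x) m)).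
have pD : {morph p : x y / x + y}.
  move=> x y; rewrite /p -big_split; apply: eq_bigr => z _ /=.
  by rewrite !lactDr qD opprD addrACA lactDr.
have pR m b : p (ract m b) = ract (p m) b.
  rewrite ract_suml; apply: eq_bigr => x _.
  by rewrite !lractA qR -ractB lractA.
have p_linear := right_linear_k (conj pD pR).
pose pl := mk_linear p_linear.
(* The retraction q is the identity on e_x J M. *)
have p_off a m : p (lact (off a) m) = 0.
  rewrite /p big1 // => x lt_xn; rewrite -lactM [q _]sigmaK // subrr.
  exact: linear0.
(* As e_x A e_x consists of multiples of e_x, the k-linear map q commutes with it. *)
have pZ a m : p (lact a m) = lact (dg a) (p m).
  rewrite {1}(diag_add_offdiag e a) lactDl pD p_off addr0.
  rewrite /p linear_sum; apply: eq_bigr => x _ /=.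
  have [c cE] := frame_scalar frame x a.
  rewrite -!lactM (frame_diagl frame) (frame_diagr frame) cE !lactZ.
  by rewrite -[q _]/(ql _) linearZ /= -scalerBr lactZr.
have p_frame x m : p (lact (e x) m) = lact (e x) (p m).
  by rewrite pZ (diag_frame frame).
have pE x m : lact (e x) (p m) =
    if (rank x < n)%N then lact (e x) (lact (e x) m - q (lact (e x) m)) else 0.
  rewrite /p linear_sum /=.
  have orth z y : z != x -> lact (e x) (lact (e z) y) = 0 :> M.
    by move=> zx; rewrite -lactM (frame_orth frame) 1?eq_sym // lact0l.
  case: ifP => lt_x.
    rewrite (bigD1 x) //= big1 ?addr0 => [|z /andP[_ zx]]; last exact: orth.
    by rewrite -lactM (frame_idem frame).
  rewrite big1 // => z lt_z; apply: orth.
  by apply: contraFneq lt_x => <-.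
have p_q m : p (q m) = 0.
  by rewrite -[p _]/(pl _) linear_sum big1 // => i _; exact: p_off.
have pp m : p (p m) = p m.
  rewrite {2}/p -[p _]/(pl _) linear_sum [RHS]lact_frame_sum.
  rewrite [RHS](bigID (fun x => (rank x < n)%N)) /= [X in _ = _ + X]big1 => [|x nlt].
    rewrite addr0; apply: eq_bigr => x lt_x.
    rewrite p_frame -[p _]/(pl _) linearB /= p_q subr0 p_frame.
    by rewrite -lactM (frame_idem frame).
  by rewrite pE (negbTE nlt).
(* The free module of row vectors over A is A (x) M in the basis of M. *)
pose u m : 'rV[A]_(\dim {:M}) :=
  \row_l \sum_x co l (lact (e x) (p m)) *: e x.
have uD : {morph u : x y / x + y}.
  move=> x y; apply/rowP => l; rewrite !mxE -big_split; apply: eq_bigr => z _ /=.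
  by rewrite pD lactDr linearD scalerDl.
have uZ a m : u (lact a m) = dg a *: u m.
  apply/rowP => l; rewrite !mxE mulr_sumr; apply: eq_bigr => x _ /=.
  have [c cE] := frame_scalar frame x a.
  rewrite pZ -lactM (frame_diagl frame) -scalerAr (frame_diagr frame) cE.
  by rewrite lactZ linearZ /= scalerA mulrC.
have up m : u (p m) = u m by apply/rowP => l; rewrite !mxE pp.
have [v vE] := @diag_extension k A X e rank frame (left_module M)
  'rV[A]_(\dim {:M}) _ (@basis_vec k M) phi phiK p u (conj pD pZ) pp (conj uD uZ) up.
pose theta l (m : M) : A := v m 0 l.
have theta_left : left_family theta.
  split=> [l x y|l a m]; first by rewrite /theta linearD mxE.
  by rewrite /theta -[lact a m]/(a *: (m : left_module M)) linearZ mxE.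
have theta_p m : splits_at theta (p m).
  have tE l y : theta l (p y) = \sum_x co l (lact (e x) (p y)) *: e x.
    by rewrite /theta vE mxE.
  split.
    rewrite [LHS]lact_frame_sum.
    under [RHS]eq_bigr do rewrite tE lact_suml.
    rewrite exchange_big; apply: eq_bigr => x _ /=.
    rewrite -[in LHS](frame_idem frame x) lactM {1}[lact (e x) (p m)]basis_vecE.
    by rewrite linear_sum; apply: eq_bigr => l _; rewrite /= lactZr lactZ.
  move=> b l'; rewrite -pR tE.
  under [RHS]eq_bigr do rewrite tE scaler_sumr.
  rewrite exchange_big; apply: eq_bigr => x _ /=.
  rewrite pR lractA [X in ract X b]basis_vecE ract_suml linear_sum scaler_suml.
  by apply: eq_bigr => l _; rewrite ractZl linearZ /= scalerA mulrC.
exists theta; split=> // x m.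
(* Nakayama: e_x m is e_x p(m) up to an element of e_x J M. *)
elim: {x}(rank x).+1 {-2}x (ltnSn (rank x)) m => // r IHr x le_xr m lt_xn.
have -> : lact (e x) m =
    lact (e x) (p m) + \sum_i lact (e x * off (abas i)) (sigma i (lact (e x) m)).
  rewrite pE lt_xn linearB /= -lactM (frame_idem frame).
  under [X in _ + X]eq_bigr do rewrite lactM.
  by rewrite -linear_sum subrK.
apply: splits_atD => //; first exact: splits_at_lact.
apply: splits_at_sum => // i _; apply: splits_at_offdiag => // z y lt_zx.
apply: IHr; last exact: ltn_trans lt_xn.
exact: leq_trans lt_zx _.
Qed.

(** The part [S] of the radical of rank at most [n] is generated by elements of
    rank below [n], so the section splits on it. Expanding the factor A of
    A (x) M in a basis turns the section into maps [sigma i], which are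
    [B]-linear on [S] and extend to [B]-linear maps on [M], as [M] is an
    injective right module. *)
Lemma radical_retract_step n :
  injective_module (right_module M) -> splits_below n -> radical_retract n.+1.
Proof.
move=> Minj [theta [theta_left theta_split]].
have [tD tL] := theta_left.
pose sigma i (m : M) : M := \sum_l coord (vbasis {:A}) i (theta l m) *: w l.
(* Elements of S are the sums of e_x J M over the x of rank at most n. *)
pose eps : A := \sum_(x | (rank x <= n)%N) e x.
pose psi (t : {ffun 'I_(\dim {:A}) -> M}) : M := \sum_i lact (eps * off (abas i)) (t i).
have psi_linear : linear psi.
  move=> c t t'; rewrite /psi scaler_sumr -big_split; apply: eq_bigr => i _.
  by rewrite !ffunE linearP.
pose S := limg (linfun (mk_linear psi_linear)).
have S_psi t : psi t \in S.
  by rewrite -[psi t](lfunE (mk_linear psi_linear)) memv_img ?memvf.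
have SP m : m \in S -> exists t, m = psi t.
  by case/memv_imgP => t _ ->; exists t; rewrite lfunE.
have S_split m : m \in S -> splits_at theta m.
  case/SP => t ->; apply: splits_at_sum => // i _.
  rewrite /eps mulr_suml lact_suml; apply: splits_at_sum => // x le_xn.
  apply: splits_at_offdiag => // z y lt_zx; apply: theta_split.
  exact: leq_trans lt_zx le_xn.
have S_ract m b : m \in S -> ract m b \in S.
  case/SP => t ->; rewrite ract_suml.
  have -> : \sum_i ract (lact (eps * off (abas i)) (t i)) b
      = psi [ffun i => ract (t i) b].
    by apply: eq_bigr => i _; rewrite ffunE lractA.
  exact: S_psi.
have sigmaD i : {morph sigma i : x y / x + y}.
  move=> x y; rewrite /sigma -big_split; apply: eq_bigr => l _.
  by rewrite tD linearD scalerDl.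
have sigmaR i b m : m \in S -> sigma i (ract m b) = ract (sigma i m) b.
  move=> /S_split[_ mR]; rewrite ract_suml /sigma.
  under eq_bigr do rewrite mR linear_sum scaler_suml.
  rewrite exchange_big; apply: eq_bigr => l _ /=.
  rewrite ractZl [in RHS](basis_vecE (ract _ b)) scaler_sumr; apply: eq_bigr => l' _.
  by rewrite linearZ /= scalerA mulrC.
have S_submod : submod_closed (mem S : {pred right_module M}).
  split=> [|b x y Sx Sy]; first exact: (mem0v S).
  by apply: (@memvD _ _ S) => //; exact: S_ract.
have /fin_all_exists[h hE] (i : 'I_(\dim {:A})) :
    exists h : {linear right_module M -> right_module M},
      {in mem S, h =1 sigma i}.
  apply: injective_extend Minj S_submod _ _ => [x y _ _|b x Sx].
    exact: sigmaD.
  exact: sigmaR.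
exists (fun i => h i); split=> [i|x a m le_xn].
  split=> [x y|m b]; first exact: linearD.
  by rewrite -[ract m b]/((b : B^c) *: (m : right_module M)) linearZ.
have Sm : lact (e x * off a) m \in S.
  have -> : lact (e x * off a) m = psi [ffun i => coord (vbasis {:A}) i (e x * a) *: m].
    have -> : e x * off a = eps * off (e x * a).
      rewrite (offdiag_frame_mul frame) mulrA; congr (_ * _).
      rewrite /eps mulr_suml (bigD1 x) //= (frame_idem frame) big1 ?addr0 //.
      by move=> z /andP[_ zx]; rewrite (frame_orth frame).
    rewrite {1}[e x * a]basis_vecE linear_sum mulr_sumr lact_suml.
    apply: eq_bigr => i _; rewrite ffunE linearZ /= -scalerAr.
    by rewrite lactZ lactZr.
  exact: S_psi.
have [mE _] := S_split _ Sm.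
rewrite [RHS]mE.
under eq_bigr => i _ do rewrite hE // /sigma linear_sum.
rewrite exchange_big; apply: eq_bigr => l _ /=.
under eq_bigr => i _ do rewrite lactZr -lactZ -linearZ.
rewrite -lact_suml -linear_sum -basis_vecE tL.
congr lact; rewrite -[LHS]/(_ - dg _).
by rewrite !(diagM frame) (diag_offdiag frame) mulr0 mul0r subr0.
Qed.

(** The two preceding lemmas alternate, starting from the zero retraction. *)
Lemma splits_everywhere :
  projective (left_module M) -> injective_module (right_module M) ->
  exists theta, left_family theta /\ forall m, @splits_at _ _ _ M theta m.
Proof.
move=> Mproj Minj.
have H n : radical_retract n.
  elim: n => [|n IHn]; last exact: radical_retract_step (splits_below_of_retract _ IHn).
  exists (fun _ _ => 0); split=> [i|//]; split=> [x y|m b]; first by rewrite addr0.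
  by rewrite ract0.
have [theta [tl ts]] := splits_below_of_retract Mproj (H (\max_x (rank x).+1)).
exists theta; split=> // m; rewrite [m]lact_frame_sum.
apply: splits_at_sum => // x _; apply: ts.
exact: (leq_bigmax x).
Qed.

End Induction.

(** * Lifting along a bimodule section *)

(** The argument [f] tells apart the module structures that different morphisms
    put on the same carrier. *)
Definition restrict_scalars (R S : pzRingType) (f : {rmorphism R -> S})
  (V : lmodType S) : Type := V.

Section RestrictScalars.
Variables (R S : pzRingType) (f : {rmorphism R -> S}) (V : lmodType S).
Local Notation fV := (restrict_scalars f V).

HB.instance Definition _ := GRing.Zmodule.copy fV V.

Definition restrict_scale (r : R) (v : fV) : fV := f r *: (v : V).
Fact restrict_scaleA a b v :
  restrict_scale a (restrict_scale b v) = restrict_scale (a * b) v.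
Proof. by rewrite /restrict_scale scalerA rmorphM. Qed.
Fact restrict_scale1 : left_id 1 restrict_scale.
Proof. by move=> v; rewrite /restrict_scale rmorph1 scale1r. Qed.
Fact restrict_scaleDr : right_distributive restrict_scale +%R.
Proof. by move=> a x y; apply: scalerDr. Qed.
Fact restrict_scaleDl v : {morph restrict_scale^~ v : a b / a + b}.
Proof. by move=> a b; rewrite /restrict_scale rmorphD scalerDl. Qed.
HB.instance Definition _ := GRing.Zmodule_isLmodule.Build R fV
  restrict_scaleA restrict_scale1 restrict_scaleDr restrict_scaleDl.

End RestrictScalars.

Section Lifting.
Variables (k : fieldType) (A B : falgType k) (M : bimodule A B).
Notation T := (tens A B^c).

Definition tens_inr (b : B^c) : T := tens_pure 1 b.

Fact tens_inr_linear : linear tens_inr.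
Proof. exact: (tens_pure_bilinear A B^c).2. Qed.
HB.instance Definition _ := GRing.isLinear.Build k B^c T _ tens_inr tens_inr_linear.
Fact tens_inr_monoid : monoid_morphism tens_inr.
Proof. by split=> // a b; rewrite /tens_inr tens_pureM mul1r. Qed.
HB.instance Definition _ := GRing.isMonoidMorphism.Build B^c T tens_inr tens_inr_monoid.

Definition tens_inl (a : A) : T := tens_pure a 1.

Fact tens_inl_linear : linear tens_inl.
Proof. exact: (tens_pure_bilinear A B^c).1. Qed.
HB.instance Definition _ := GRing.isLinear.Build k A T _ tens_inl tens_inl_linear.
Fact tens_inl_monoid : monoid_morphism tens_inl.
Proof. by split=> // a b; rewrite /tens_inl tens_pureM mul1r. Qed.
HB.instance Definition _ := GRing.isMonoidMorphism.Build A T tens_inl tens_inl_monoid.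

Lemma tens_inlr a b : tens_inl a * tens_inr b = tens_pure a b.
Proof. by rewrite /tens_inl /tens_inr tens_pureM mulr1 mul1r. Qed.

Lemma tens_inrl a b : tens_inr b * tens_inl a = tens_pure a b.
Proof. by rewrite /tens_inl /tens_inr tens_pureM mulr1 mul1r. Qed.

(** Scalars are absorbed in the left factor, so pure tensors generate additively. *)
Lemma tens_additive_ind (P : T -> Prop) :
  P 0 -> (forall t u, P t -> P u -> P (t + u)) ->
  (forall a b, P (tens_inl a * tens_inr b)) -> forall t, P t.
Proof.
move=> P0 PD Pp t; rewrite (tensE t).
apply: big_ind => // i _; apply: big_ind => // j _.
by rewrite -tens_inlr scalerAl -linearZ.
Qed.

Lemma enveloping_linear (N : lmodType T) (h : enveloping_module M -> N) :
  {morph h : x y / x + y} ->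
  (forall a m, h (lact a m) = tens_inl a *: h m) ->
  (forall m b, h (ract m b) = tens_inr b *: h m) ->
  linear h.
Proof.
move=> hD hL hR t x y; rewrite hD; congr (_ + _).
elim/tens_additive_ind: t => [|t u Et Eu|a b].
- have h0 : h 0 = 0 by apply: (addrI (h 0)); rewrite -hD !addr0.
  by rewrite !scale0r.
- by rewrite !scalerDl hD Et Eu.
rewrite -[RHS]scalerA -hR -hL tens_inlr; congr h.
exact: env_scale_pure.
Qed.

(** A (x) M is a projective bimodule when [M] is right projective, and a bimodule
    section makes [M] a direct summand of it. Concretely, a [B]-linear lift
    [h0] of [f] gives the bimodule lift
    [m |-> \sum_l theta l m *: h0 (w l)]. *)
Lemma bimodule_projective_of_splits theta :
  left_family theta -> (forall m, @splits_at _ _ _ M theta m) ->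
  projective (right_module M) -> bimodule_projective M.
Proof.
move=> [tD tL] split_all Mproj N N' g f g_surj.
pose NB : lmodType B^c := restrict_scalars tens_inr N.
pose NB' : lmodType B^c := restrict_scalars tens_inr N'.
have gB_linear : linear (g : NB -> NB') by move=> b x y; apply: linearP.
have fB_linear : linear (f : right_module M -> NB').
  move=> b x y; rewrite linearD; congr (_ + _).
  rewrite -[RHS]/(tens_inr b *: f x) -linearZ; congr (f _).
  by rewrite -[RHS]/(env_scale (tens_pure 1 b) x) env_scale_pure lact1.
have [h0 h0K] := Mproj NB NB' (mk_linear gB_linear) (mk_linear fB_linear) g_surj.
have h0R b (m : M) : (h0 (ract m b) : N) = tens_inr b *: (h0 m : N).
  exact: (linearZ_LR h0 (b : B^c) (m : right_module M)).
pose w := @basis_vec k M.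
pose h (m : enveloping_module M) : N := \sum_l tens_inl (theta l m) *: (h0 (w l) : N).
have hD : {morph h : x y / x + y}.
  move=> x y; rewrite /h -big_split; apply: eq_bigr => l _.
  by rewrite tD linearD scalerDl.
have hL a m : h (lact a m) = tens_inl a *: h m.
  rewrite /h scaler_sumr; apply: eq_bigr => l _.
  by rewrite tL rmorphM scalerA.
have hR m b : h (ract m b) = tens_inr b *: h m.
  rewrite /h scaler_sumr.
  under eq_bigr => l' _ do rewrite (split_all m).2 linear_sum scaler_suml.
  rewrite exchange_big; apply: eq_bigr => l _ /=.
  rewrite scalerA tens_inrl -tens_inlr -scalerA -h0R.
  rewrite [X in h0 X](basis_vecE (ract (w l) b : M)).
  have h0_sum F : (h0 (\sum_i F i : M) : N) = \sum_(i < \dim {:M}) (h0 (F i) : N).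
    exact: (linear_sum h0).
  rewrite h0_sum scaler_sumr; apply: eq_bigr => l' _.
  rewrite -ract_scalar h0R scalerA; congr (_ *: _).
  by rewrite linearZ /= [tens_inr _]linearZ -scalerAr rmorph1 mulr1.
exists (mk_linear (enveloping_linear hD hL hR)) => m.
rewrite linear_sum [in RHS](split_all m).1 linear_sum; apply: eq_bigr => l _.
have h0Kl : g (h0 (w l) : N) = f (w l) by exact: h0K.
rewrite linearZ /= h0Kl -linearZ; congr (f _).
by rewrite -[LHS]/(env_scale (tens_pure _ _) _) env_scale_pure ract1.
Qed.

End Lifting.

(** * Quotients of path algebras of acyclic quivers *)

Section QuiverRank.
Variable Q : quiver.

Definition adjacent (x z : vertex Q) : bool :=
  [exists a : arrow Q, (src a == x) && (tgt a == z)].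

(** The number of vertices that a path from [x] can reach; it drops along every
    nontrivial path of an acyclic quiver. *)
Definition reach_rank (x : vertex Q) : nat := #|connect adjacent x|.

Lemma walk_connect x s : is_walk x s -> connect adjacent x (walk_end x s).
Proof.
elim: s x => [|a s IHs] x /=; first by rewrite connect0.
case/andP => /eqP <- /IHs; apply: connect_trans; apply: connect1.
by apply/existsP; exists a; rewrite !eqxx.
Qed.

Lemma connect_walk x z :
  connect adjacent x z -> exists2 s, is_walk x s & walk_end x s = z.
Proof.
case/connectP => r; elim: r x => [|y r IHr] x /=; first by move=> _ ->; exists [::].
case/andP => /existsP[a /andP[/eqP ax /eqP ay]] /IHr{}IHr /IHr[s s_walk s_end].
by exists (a :: s); rewrite /walk_end /= ?ax ?eqxx ay.
Qed.

(** Everything reachable from the end is reachable from the start, and the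
    start is not reachable from the end, since a path back would close a cycle. *)
Lemma reach_rank_lt (p : qpath Q) :
  acyclic Q -> qstart p != qend p -> (reach_rank (qend p) < reach_rank (qstart p))%N.
Proof.
move=> Q_acyclic ne; have c_p := walk_connect (valP p).
apply: proper_card; apply/properP; split.
  by apply/subsetP => y; apply: connect_trans.
exists (qstart p); first exact: connect0.
apply/negP => /connect_walk[s s_walk s_end].
have loop : is_walk (qstart p) (qarrows p ++ s).
  by rewrite is_walk_cat (valP p).
have := Q_acyclic (@QPath Q (_, _) loop).
rewrite /qend /qstart /qlength /qarrows /= /walk_end map_cat last_cat => /(_ s_end).
move/eqP; rewrite size_cat addn_eq0 => /andP[/nilP p0 _].
by move: ne; rewrite /qend /walk_end /qarrows p0 /= eqxx.
Qed.

End QuiverRank.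

Section QuiverFrame.
Variables (k : fieldType) (Q : quiver).
Notation kQ := (path_algebra k Q).
Notation triv x := (path_elt k (qtriv x)).

Lemma path_corner (x z : vertex Q) (p : qpath Q) :
  triv x * path_elt k p * triv z =
  if (x == qstart p) && (qend p == z) then path_elt k p else 0 :> kQ.
Proof.
rewrite path_eltM /path_elt_mul qcat1l; case: eqP => _ /=; last exact: mul0r.
by rewrite path_eltM /path_elt_mul qcat1r; case: eqP.
Qed.

(** The conditions on [e x * a * e z] are linear in [a], so they are checked on
    paths: a path from [x] to [x] is trivial, and one from [x] to another vertex
    lowers the rank. *)
Lemma acyclic_frame (A : falgType k) (pi : {linear kQ -> A}) :
  acyclic Q -> monoid_morphism pi -> (forall a, exists f, pi f = a) ->
  directed_frame (fun x => pi (triv x)) (@reach_rank Q).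
Proof.
move=> Q_acyclic [pi1 piM] pi_surj; split.
- by rewrite -linear_sum -[RHS]pi1.
- move=> x; rewrite -piM path_eltM /path_elt_mul qcat1l /=.
  by rewrite eqxx.
- move=> x z xz; rewrite -piM path_eltM /path_elt_mul qcat1l /=.
  by rewrite (negbTE xz) linear0.
- move=> x a; have [f <-] := pi_surj a.
  elim/path_algebra_ind: f => [|c f g [cf Ef] [cg Eg]|p].
  + by exists 0; rewrite linear0 mulr0 mul0r scale0r.
  + exists (c * cf + cg).
    by rewrite linearP mulrDr mulrDl -scalerAr -scalerAl Ef Eg scalerA scalerDl.
  rewrite -!piM path_corner; case: andP => [[/eqP xp /eqP px]|_]; last first.
    by exists 0; rewrite linear0 scale0r.
  exists 1; rewrite scale1r; congr (pi (path_elt k _)).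
  apply: qpath_inj; rewrite -?xp //; apply: size0nil.
  by apply: Q_acyclic; rewrite px.
move=> x z a xz le_xz; have [f <-] := pi_surj a.
elim/path_algebra_ind: f => [|c f g Ef Eg|p].
- by rewrite linear0 mulr0 mul0r.
- by rewrite linearP mulrDr mulrDl -scalerAr -scalerAl Ef Eg scaler0 addr0.
rewrite -!piM path_corner; case: andP => [[/eqP xp /eqP pz]|_]; last exact: linear0.
have := @reach_rank_lt Q p Q_acyclic.
by rewrite -xp pz => /(_ xz); rewrite ltnNge le_xz.
Qed.

End QuiverFrame.

Theorem theorem40 (k : fieldType) (Q : quiver) (I : path_algebra k Q -> Prop)
    (A B : falgType k) (pi : {linear path_algebra k Q -> A})
    (Q_acyclic : acyclic Q) (I_admissible : admissible I)
    (A_def : is_quotient_map I pi) (B_selfinj : self_injective B)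
    (M : bimodule A B) :
  left_right_projective M -> bimodule_projective M.
Proof.
move=> [Mleft Mright].
have [pi_morph pi_surj _] := A_def.
have frame := acyclic_frame Q_acyclic pi_morph pi_surj.
have Minj := projective_injective (@basis_vec_gen_right _ _ _ M) B_selfinj Mright.
have [theta [theta_left theta_splits]] := splits_everywhere frame Mleft Minj.
exact: bimodule_projective_of_splits theta_left theta_splits Mright.
Qed.
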